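(* For all integers $d\ge 1$ and $n\ge 1$, the directed metric dimension of $\vec{\mathcal B}(d,n)$ is $d^{n-1}(d-1)$.
   Context: $\mathcal A_d=\{0,1,\dots,d-1\}$. The directed de Bruijn graph $\vec{\mathcal B}(d,n)$ has vertex set $\mathcal A_d^n$ (strings of length $n$ over $\mathcal A_d$) and an arc from $x_1\cdots x_n$ to $y_1\cdots y_n$ iff $x_2\cdots x_n=y_1\cdots y_{n-1}$. $\vec d(u,v)$ is the length of a shortest directed walk from $u$ to $v$ ($\vec d(v,v)=0$). A directed resolving set is a set $S$ of vertices such that for all distinct vertices $u,v$ there is $s\in S$ with $\vec d(s,u)\ne\vec d(s,v)$. The directed metric dimension is the minimum size of a directed resolving set. *)

(* Defs.v *)
From mathcomp Require Import all_boot.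

Set Implicit Arguments.
Unset Strict Implicit.
Unset Printing Implicit Defensive.

Section DirectedMetricDimension.

Variables (T : finType) (e : rel T).

Definition walk (u v : T) (k : nat) : bool :=
  [exists p : k.-tuple T, path e u p && (last u p == v)].

Lemma connect_walk u v : connect e u v -> exists k, walk u v k.
Proof.
by case/connectP=> p ep ->; exists (size p); apply/existsP; exists (in_tuple p);
  rewrite ep eqxx.
Qed.

(* None stands for infinite distance. *)
Definition ddist (u v : T) : option nat :=
  match @idP (connect e u v) with
  | ReflectT uv => Some (ex_minn (connect_walk uv))
  | ReflectF _ => None
  end.

Lemma ddistP u v k :
  ddist u v = Some k <-> walk u v k /\ forall m, walk u v m -> k <= m.
Proof.
have conn m : walk u v m -> connect e u v.
  by case/existsP=> p /andP[ep /eqP <-]; apply/connectP; exists p.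
rewrite /ddist; case: {-}_ / idP => [uv|nuv]; last first.
  by split=> // -[/conn].
case: ex_minnP => m wm minm; split=> [[<-] //|[wk mink]].
by congr Some; apply/eqP; rewrite eqn_leq minm // mink.
Qed.

Definition directed_resolving (S : {set T}) : bool :=
  [forall u, forall v, (u != v) ==> [exists s in S, ddist s u != ddist s v]].

(* The full vertex set is always resolving (see [directed_resolving_setT]),
   so this is a genuine minimum. *)
Definition directed_metric_dim : nat :=
  #|[arg min_(S < [set: T] | directed_resolving S) #|S| ]|.

Lemma directed_resolving_setT : directed_resolving [set: T].
Proof.
apply/forallP=> u; apply/forallP=> v; apply/implyP=> neq_uv.
apply/existsP; exists u; rewrite inE /=; apply/eqP.
have -> : ddist u u = Some 0.
  by apply/ddistP; split=> //; apply/existsP; exists [tuple]; rewrite /= eqxx.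
move/esym/ddistP=> [/existsP[p /andP[_ last_p]] _].
by move: last_p; rewrite (tuple0 p) /= (negPf neq_uv).
Qed.

End DirectedMetricDimension.

Definition de_bruijn (d n : nat) : rel (n.-tuple 'I_d) :=
  fun x y => behead x == take n.-1 y.

(* Main.v *)
Require Import Defs.
From mathcomp Require Import all_boot.

Set Implicit Arguments.
Unset Strict Implicit.
Unset Printing Implicit Defensive.

(** In the de Bruijn graph a walk of length [k] from [s] to [u] exists iff [s]
    without its first [k] letters is a prefix of [u].  Vertices that differ only
    in their last letter have the same in-neighbours, so no third vertex
    distinguishes them: a resolving set misses at most one vertex for each of
    the [d ^ (n - 1)] prefixes of length [n - 1].
    Conversely, for any letter [a], the vertices not ending in [a] are
    resolving.  If [u] and [v] differ in position [i] then one of [u_i], [v_i],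
    say [u_i], is not [a], and any vertex [s] with suffix [u_0 ... u_i] resolves
    them: [s] is within distance [n - i - 1] of [u], so equal distances would
    force [u] and [v] to share a prefix containing position [i]. *)

Section Digraph.

Variables (T : finType) (e : rel T).
Implicit Types (s u v w : T) (S : {set T}).

Lemma walkP u v k :
  reflect (exists p, [/\ path e u p, last u p = v & size p = k]) (walk e u v k).
Proof.
apply: (iffP existsP) => [[p /andP[ep /eqP lp]]|[p [ep lp sp]]].
  by exists p; rewrite size_tuple.
by case: _ / sp; exists (in_tuple p); rewrite /= ep lp eqxx.
Qed.

Lemma walk0 u v : walk e u v 0 = (u == v).
Proof.
apply/walkP/eqP => [[p [_ lp /size0nil p0]]|uv]; last by exists [::].
by rewrite -lp p0.
Qed.

Lemma walkS u v k : walk e u v k.+1 = [exists w, walk e u w k && e w v].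
Proof.
apply/walkP/existsP => [[p]|[w /andP[/walkP[p [ep lp sp]] ewv]]].
  case/lastP: p => [[//]|p w].
  rewrite rcons_path last_rcons size_rcons => -[/andP[ep ew] <- [sp]].
  by exists (last u p); rewrite ew andbT; apply/walkP; exists p.
by exists (rcons p v); rewrite rcons_path ep lp last_rcons size_rcons sp.
Qed.

Lemma ddist_leq_walk u v k : walk e u v k ->
  exists m, [/\ ddist e u v = Some m, walk e u v m & m <= k].
Proof.
move=> wk; case: (@ex_minnP (walk e u v) (ex_intro _ k wk)) => m wm minm.
by exists m; split; [apply/ddistP | | exact: minm].
Qed.

Lemma eq_ddist s u v : walk e s u =1 walk e s v -> ddist e s u = ddist e s v.
Proof.
have ddist_Some x y m :
    walk e s x =1 walk e s y -> ddist e s x = Some m -> ddist e s y = Some m.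
  move=> xy /ddistP[wm minm]; apply/ddistP.
  by split=> [|k]; rewrite -xy //; exact: minm.
move=> uv; case Du: (ddist e s u) => [m|]; first by rewrite (ddist_Some u v m).
case Dv: (ddist e s v) => [m|//].
by rewrite (ddist_Some v u m) in Du => // k; rewrite uv.
Qed.

Lemma ddist_neq s u v k : walk e s u k ->
    (forall m, m <= k -> walk e s u m -> ~~ walk e s v m) ->
  ddist e s u != ddist e s v.
Proof.
move=> /ddist_leq_walk[m [-> wu mk]] nwalk; apply/eqP => /esym/ddistP[wv _].
by have /negP := nwalk m mk wu.
Qed.

Lemma directed_resolvingP S :
  reflect
    (forall u v, u != v -> exists2 s, s \in S & ddist e s u != ddist e s v)
    (directed_resolving e S).
Proof.
apply: (iffP idP) => [/forallP resS u v uv|resS].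
  by have /forallP/(_ v)/implyP/(_ uv)/exists_inP := resS u.
by apply/forallP=> u; apply/forallP=> v; apply/implyP=> uv;
  apply/exists_inP/resS.
Qed.

Lemma directed_metric_dim_eq k :
    (exists2 S, directed_resolving e S & #|S| <= k) ->
    (forall S, directed_resolving e S -> k <= #|S|) ->
  directed_metric_dim e = k.
Proof.
move=> [S resS cardS] minS; rewrite /directed_metric_dim.
case: arg_minnP => [|A resA minA]; first exact: directed_resolving_setT.
by apply/eqP; rewrite eqn_leq minS // (leq_trans (minA S resS)).
Qed.

Definition in_twins u v : Prop := e^~ u =1 e^~ v.

Lemma ddist_in_twins s u v :
  in_twins u v -> s != u -> s != v -> ddist e s u = ddist e s v.
Proof.
move=> uv su sv; apply: eq_ddist => -[|k].
  by rewrite !walk0 (negPf su) (negPf sv).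
by rewrite !walkS; apply: eq_existsb => w; rewrite uv.
Qed.

Lemma directed_resolving_in_twins S u v :
    directed_resolving e S -> in_twins u v -> u \notin S -> v \notin S ->
  u = v.
Proof.
move=> /directed_resolvingP resS uv uS vS; apply/eqP/negPn/negP => /resS[s sS].
by case/eqP; apply: ddist_in_twins => //; apply: contraTneq sS => ->.
Qed.

Lemma leq_card_directed_resolving (I : finType) (f : T -> I) S :
    (forall u v, f u = f v -> in_twins u v) ->
  directed_resolving e S -> #|T| <= #|S| + #|I|.
Proof.
move=> f_twins resS; rewrite -(cardsC S) leq_add2l.
apply: (leq_card_in f) => u v; rewrite !inE => uS vS /f_twins uv.
exact: directed_resolving_in_twins resS uv uS vS.
Qed.

End Digraph.

Lemma behead_take (T : Type) k (s : seq T) :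
  behead (take k s) = take k.-1 (behead s).
Proof. by case: k s => [|k] [|x s] //=; rewrite take0. Qed.

Lemma card_tuple_last_in (T : finType) n (x : T) (A : {set T}) :
  #|[set t : n.+1.-tuple T | last x t \in A]| = #|T| ^ n * #|A|.
Proof.
pose append (ty : n.-tuple T * T) : n.+1.-tuple T := [tuple of rcons ty.1 ty.2].
have append_inj : injective append.
  by move=> [t y] [t' y'] /(congr1 val) /= /rcons_inj[/val_inj-> ->].
have -> : [set t : n.+1.-tuple T | last x t \in A] = append @: setX setT A.
  apply/setP => t; apply/idP/imsetP => [|[[t' y]]]; last first.
    by rewrite !inE /= => yA ->; rewrite /= last_rcons.
  case/tupleP: t => y t; rewrite inE /= => tA.
  exists (belast_tuple y t, last y t); first by rewrite !inE.
  by apply: val_inj; rewrite /= -lastI.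
by rewrite card_imset // cardsX cardsT card_tuple.
Qed.

Section DeBruijn.

Variables d n : nat.
Implicit Types (a : 'I_d) (s u v w : n.-tuple 'I_d).
Local Notation e := (@de_bruijn d n).

Lemma walk_de_bruijn s u k : walk e s u k = (drop k s == take (n - k) u).
Proof.
elim: k u => [|k IHk] u.
  by rewrite walk0 drop0 subn0 take_oversize ?size_tuple.
rewrite walkS; apply/existsP/eqP => [[w]|su].
  rewrite IHk => /andP[/eqP sw /eqP wu].
  rewrite -add1n -drop_drop sw drop1 behead_take wu -subnS take_takel //.
  by rewrite -subn1 leq_sub2l.
case: n s u su IHk => [|m] s u su IHk.
  by exists u; rewrite IHk (tuple0 s) (tuple0 u).
have size_w : size (nth (thead u) s k :: take m u) == m.+1.
  by rewrite /= size_takel // size_tuple.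
exists (Tuple size_w); rewrite IHk /de_bruijn /= eqxx andbT.
have [km|mk] := leqP k m; last first.
  by rewrite drop_oversize ?size_tuple // (eqP mk).
rewrite (drop_nth (thead u)) ?size_tuple // su (subSn km) subSS /=.
by rewrite take_takel ?leq_subr.
Qed.

Lemma ddist_de_bruijn_neq s u v k :
    drop k s = take (n - k) u -> take (n - k) u != take (n - k) v ->
  ddist e s u != ddist e s v.
Proof.
move=> su uv; apply: (ddist_neq (k := k)) => [|m mk].
  by rewrite walk_de_bruijn su.
rewrite !walk_de_bruijn => /eqP ->; apply: contraNneq uv => uvm.
by rewrite -(take_takel _ (leq_sub2l n mk)) uvm take_takel ?leq_sub2l.
Qed.

(* [last a s] is [a] when [n = 0], so the set is then empty. *)
Definition last_neq a : {set n.-tuple 'I_d} :=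
  [set s : n.-tuple 'I_d | last a s != a].

Lemma last_neq_resolves a u v (i : 'I_n) :
    tnth u i != a -> tnth u i != tnth v i ->
  exists2 s, s \in last_neq a & ddist e s u != ddist e s v.
Proof.
move=> uia uvi; have i_lt_u : i < size u by rewrite size_tuple.
have size_s : size (nseq (n - i.+1) a ++ take i.+1 u) == n.
  by rewrite size_cat size_nseq size_takel // subnK.
exists (Tuple size_s).
  by rewrite inE /= (take_nth a) // last_cat last_rcons -tnth_nth.
apply: (ddist_de_bruijn_neq (k := n - i.+1)); rewrite subKn //=.
  by rewrite drop_size_cat ?size_nseq.
apply: contraNneq uvi => uv.
by rewrite !(tnth_nth a) -(nth_take _ (ltnSn i)) uv nth_take.
Qed.

Lemma last_neq_resolving a : directed_resolving e (last_neq a).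
Proof.
apply/directed_resolvingP => u v uv.
have [i uvi] : exists i, tnth u i != tnth v i.
  apply/existsP; apply: contraR uv; rewrite negb_exists => /forallP uv.
  by apply/eqP/eq_from_tnth => i; apply/eqP/negPn/uv.
have [ua|ua] := eqVneq (tnth u i) a; last exact: last_neq_resolves ua uvi.
have vui : tnth v i != tnth u i by rewrite eq_sym.
have va : tnth v i != a by rewrite -ua.
have [s sS Ds] := last_neq_resolves va vui.
by exists s; rewrite // eq_sym.
Qed.

Lemma de_bruijn_in_twins u v : take n.-1 u = take n.-1 v -> in_twins e u v.
Proof. by move=> uv w; rewrite /de_bruijn uv. Qed.

Lemma leq_card_de_bruijn_resolving (S : {set n.-tuple 'I_d}) :
  directed_resolving e S -> d ^ n <= #|S| + d ^ n.-1.
Proof.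
pose prefix u : (minn n.-1 n).-tuple 'I_d := [tuple of take n.-1 u].
have prefix_twins u v : prefix u = prefix v -> in_twins e u v.
  by move/(congr1 val)/de_bruijn_in_twins.
move/(leq_card_directed_resolving prefix_twins).
by rewrite !card_tuple card_ord (minn_idPl (leq_pred n)).
Qed.

End DeBruijn.

Lemma card_last_neq d n (a : 'I_d) : #|last_neq n.+1 a| = d ^ n * d.-1.
Proof.
rewrite -[d in RHS]card_ord -(cardsC1 a) -(card_tuple_last_in _ a).
by apply: eq_card => t; rewrite !inE.
Qed.

Theorem theorem4p6 (d n : nat) (hd : 1 <= d) (hn : 1 <= n) :
  directed_metric_dim (@de_bruijn d n) = d ^ (n - 1) * (d - 1).
Proof.
case: n hn => // n _; rewrite !subn1 /=; apply: directed_metric_dim_eq => [|S].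
  exists (last_neq n.+1 (Ordinal hd)); first exact: last_neq_resolving.
  by rewrite card_last_neq.
move/leq_card_de_bruijn_resolving.
by rewrite /= -subn1 mulnBr muln1 -expnSr leq_subLR addnC.
Qed.
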